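(* Let $n \geq 1$ and let $A_1,\ldots,A_n \in \mathrm{SL}(2,\mathbb{R})$. Then $$ \frac{1}{2\pi}\int_0^{2\pi} \log\rho\left( A_n R_{\theta} \cdots A_1 R_{\theta} \right) d\theta = \sum_{j=1}^{n} N(A_j). $$
   Context: $\mathrm{SL}(2,\mathbb{R})$ is the group of real $2\times 2$ matrices of determinant $1$. For a matrix $A$, $\|A\| = \sup_{v\neq 0} \|Av\|/\|v\|$ is the operator norm with respect to the Euclidean norm, and $\rho(A)$ is the spectral radius, i.e. the maximum absolute value of the (complex) eigenvalues of $A$. For $A\in \mathrm{SL}(2,\mathbb{R})$, $$N(A)=\log\left(\frac{\|A\|+\|A\|^{-1}}{2}\right).$$ For $\theta\in\mathbb{R}$, $R_\theta=\begin{pmatrix}\cos\theta & -\sin\theta\\ \sin\theta & \cos\theta\end{pmatrix}$. The product $A_n R_\theta\cdots A_1R_\theta$ is $(A_nR_\theta)(A_{n-1}R_\theta)\cdots(A_1R_\theta)$. *)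

(* Defs.v *)
From mathcomp Require Import all_boot all_order all_algebra.
From mathcomp Require Import all_classical all_reals all_analysis.
From mathcomp Require Import complex.

Set Implicit Arguments.
Unset Strict Implicit.
Unset Printing Implicit Defensive.

Import Order.TTheory GRing.Theory Num.Theory.

Local Open Scope classical_set_scope.
Local Open Scope ring_scope.
Local Open Scope complex_scope.

(* The norm that MathComp-Analysis puts on matrices is the sup norm of the
   entries, hence the explicit Euclidean norm. *)
Definition enorm (R : realType) (n : nat) (v : 'cV[R]_n) : R :=
  Num.sqrt (\sum_(i < n) v i 0 ^+ 2).

Definition opnorm (R : realType) (m n : nat) (A : 'M[R]_(m, n)) : R :=
  sup [set enorm (A *m v) / enorm v | v in [set v : 'cV[R]_n | v != 0]].

(* The set of moduli is finite, and nonempty for n > 0, so that its [sup] is a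
   maximum. [eigenvalue] is about row eigenvectors; a square matrix has the
   same eigenvalues on rows and on columns. The norm of [R[i]] takes its values
   in [R[i]], whence the [complex.Re]. *)
Definition specrad (R : realType) (n : nat) (A : 'M[R]_n) : R :=
  sup [set complex.Re `|z|
      | z in [set z : R[i] | eigenvalue (map_mx (real_complex R) A) z]].

Definition logN (R : realType) (A : 'M[R]_2) : R :=
  ln ((opnorm A + (opnorm A)^-1) / 2).

Definition rotation (R : realType) (t : R) : 'M[R]_2 :=
  \matrix_(i, j) if i == j then cos t else if (i < j)%N then - sin t else sin t.

(* Matrices are indexed from 0 and the last one comes leftmost: the value is
   (A_(n-1) R_t) ... (A_1 R_t) (A_0 R_t). *)
Definition rotprod (R : realType) (n : nat) (A : 'I_n -> 'M[R]_2) (t : R) :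
    'M[R]_2 :=
  \prod_(i < n) (A (rev_ord i) *m rotation t).

(* Main.v *)
Require Import Defs.
From mathcomp Require Import all_boot all_order all_algebra.
From mathcomp Require Import all_classical all_reals all_analysis.
From mathcomp Require Import complex ring lra.

Import Order.TTheory GRing.Theory Num.Theory.
Import Normc.
Import numFieldNormedType.Exports.

Local Open Scope classical_set_scope.
Local Open Scope ring_scope.

(* For [z = e^{it}] the matrix [z R_t] equals [z^2 E + E'], where [E] and [E'] are
   the spectral projections of the rotations; this makes sense for every complex
   [z], and the product [M z] of the [A_j (z^2 E + E')] is polynomial in [z]. For
   [|z| < 1] it contracts the indefinite Hermitian form preserved by [SL(2, R)],
   so that one eigenvalue of [M z] has modulus at least 1 and the other one at
   most [|z|]. Hence the trace of [(M z)^k] has no zero in the open unit disc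
   and [ln |tr (M z)^k|] has the mean value property on circles of radius
   [r < 1]. Dividing by [k] and letting [k] tend to infinity, so does the log of
   the spectral radius; its value at 0, where [M 0] has rank one, is the sum of
   the [N(A_j)]. It remains to let [r] tend to 1. *)

(** * Modulus, spectral radius of 2 x 2 matrices *)

Section Matrix2.
Context {K : comNzRingType}.

Lemma det_mx2 (M : 'M[K]_2) : \det M = M 0 0 * M 1 1 - M 0 1 * M 1 0.
Proof.
rewrite (expand_det_row _ 0) big_ord_recl big_ord1 /cofactor !det_mx11 !mxE /=.
rewrite expr0 expr1 mul1r mulN1r mulrN.
by congr (_ * M _ _ - M _ _ * M _ _); apply/val_inj.
Qed.

Lemma mxtrace2 (M : 'M[K]_2) : \tr M = M 0 0 + M 1 1.
Proof.
by rewrite /mxtrace big_ord_recl big_ord1; congr (_ + M _ _); apply/val_inj.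
Qed.

Lemma mulmx2E m p (A : 'M[K]_(m, 2)) (B : 'M[K]_(2, p)) i j :
  (A *m B) i j = A i 0 * B 0 j + A i 1 * B 1 j.
Proof.
by rewrite mxE big_ord_recl big_ord1; congr (_ + A _ _ * B _ _); apply/val_inj.
Qed.

End Matrix2.

Section Modulus.
Set Implicit Arguments.
Unset Strict Implicit.
Context {R : realType}.
Implicit Types z w a b : R[i].

Lemma normc_ge0 z : 0 <= normc z.
Proof. by case: z => x y; rewrite sqrtr_ge0. Qed.

Lemma normcE_sqrt z : normc z = Num.sqrt (complex.Re z ^+ 2 + complex.Im z ^+ 2).
Proof. by case: z. Qed.

Lemma sqr_normcE z : normc z ^+ 2 = complex.Re z ^+ 2 + complex.Im z ^+ 2.
Proof. by rewrite normcE_sqrt sqr_sqrtr// addr_ge0 ?sqr_ge0. Qed.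

Lemma normc_eq0 z : (normc z == 0) = (z == 0).
Proof. by apply/eqP/eqP => [/eq0_normc//|->]; rewrite normc0. Qed.

Lemma normc_gt0 z : (0 < normc z) = (z != 0).
Proof. by rewrite lt0r normc_eq0 normc_ge0 andbT. Qed.

Lemma normcX z n : normc (z ^+ n) = normc z ^+ n.
Proof. by elim: n => [|n IH]; rewrite ?expr0 ?normc1// !exprS normcM IH. Qed.

Lemma normc_real (x : R) : normc (x%:C)%C = `|x|.
Proof. by rewrite normcE_sqrt /= expr0n addr0 sqrtr_sqr. Qed.

Lemma normc_prod (I : Type) (s : seq I) (F : I -> R[i]) :
  normc (\prod_(i <- s) F i) = \prod_(i <- s) normc (F i).
Proof.
by elim: s => [|i s IH]; rewrite ?big_nil ?normc1// !big_cons normcM IH.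
Qed.

Lemma normcD_ge z w : normc z - normc w <= normc (z + w).
Proof.
by rewrite lerBlDr; have := le_normcD (z + w) (- w); rewrite addrK normcN.
Qed.

Lemma sqr_normcD z w : normc (z + w) ^+ 2 + normc (z - w) ^+ 2 =
  2 * (normc z ^+ 2 + normc w ^+ 2).
Proof. by case: z w => [x y] [u v]; rewrite !sqr_normcE /=; ring. Qed.

(* The largest modulus of the roots of ['X^2 - T 'X + D], written without
   choosing a square root of the discriminant so as to be visibly continuous:
   the two radicands are [(|a| + |b|)^2] and [(|a| - |b|)^2]. *)
Definition rad (T D : R[i]) : R :=
  let S := (normc T ^+ 2 + normc (T ^+ 2 - 4 * D)) / 2 in
  (Num.sqrt (S + 2 * normc D) + Num.sqrt (S - 2 * normc D)) / 2.

Lemma rad_max a b : rad (a + b) (a * b) = Num.max (normc a) (normc b).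
Proof.
rewrite /rad (_ : (a + b) ^+ 2 - 4 * (a * b) = (a - b) ^+ 2); last by ring.
rewrite normcX sqr_normcD normcM [2 * (_ + _)]mulrC mulfK ?pnatr_eq0//.
rewrite (_ : _ + 2 * _ = (normc a + normc b) ^+ 2); last by ring.
rewrite (_ : _ - 2 * _ = (normc a - normc b) ^+ 2); last by ring.
rewrite !sqrtr_sqr ger0_norm ?addr_ge0 ?normc_ge0//.
by rewrite -maxr_absE.
Qed.

(** Multiplying a 2 x 2 matrix by a scalar [u] multiplies its trace by [u] and its determinant by
    [u ^+ 2]. This lets [R_t] be replaced by [z R_t] on the unit circle. *)
Lemma rad_unit u T D : normc u = 1 -> rad (u * T) (u ^+ 2 * D) = rad T D.
Proof.
move=> u1; rewrite /rad.
rewrite (_ : (u * T) ^+ 2 - _ = u ^+ 2 * (T ^+ 2 - 4 * D)); last by ring.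
have e1 w : normc (u * w) = normc w by rewrite normcM u1 mul1r.
have e2 w : normc (u ^+ 2 * w) = normc w by rewrite expr2 -mulrA !e1.
by rewrite e1 !e2.
Qed.

Lemma quadratic_roots (T D : R[i]) : exists a b, T = a + b /\ D = a * b.
Proof.
pose s := sqrtc (T ^+ 2 - 4 * D).
exists ((T + s) / 2), ((T - s) / 2); split; first by field.
rewrite (_ : _ * _ = (T ^+ 2 - s ^+ 2) / 4); last by field.
by rewrite /s sqr_sqrtc; field.
Qed.

Lemma eigenvalue2 (M : 'M[R[i]]_2) a b :
  \tr M = a + b -> \det M = a * b -> forall z, eigenvalue M z = (z == a) || (z == b).
Proof.
move=> tM dM z; rewrite eigenvalue_root_char /root.
have -> : (char_poly M).[z] = (z - a) * (z - b).
  rewrite /char_poly -horner_evalE -det_map_mx.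
  have -> : (z - a) * (z - b) = z ^+ 2 - \tr M * z + \det M.
    by rewrite tM dM; ring.
  rewrite !det_mx2 mxtrace2 !mxE /= /horner_eval !hornerE /=; ring.
by rewrite mulf_eq0 !subr_eq0.
Qed.

Lemma specrad2 (M : 'M[R]_2) : specrad M = rad (\tr M)%:C%C (\det M)%:C%C.
Proof.
have [a [b [ta db]]] := quadratic_roots (\tr M)%:C%C (\det M)%:C%C.
rewrite ta db rad_max /specrad.
set S := (X in sup X).
have -> : S = [set x | x = normc a \/ x = normc b].
  apply/seteqP; rewrite /S; split => [x [z]|x].
    rewrite /mkset (@eigenvalue2 _ a b) ?trace_map_mx ?det_map_mx//.
    by case/orP => /eqP -> <-; rewrite normc_def -normcE_sqrt; [left|right].
  by case=> ->; [exists a|exists b]; rewrite /mkset;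
    do ?[rewrite normc_def -normcE_sqrt//];
    rewrite (@eigenvalue2 _ a b) ?trace_map_mx ?det_map_mx ?eqxx ?orbT.
apply/eqP; rewrite eq_le; apply/andP; split.
  apply: ge_sup; first by exists (normc a); left.
  by move=> x [] ->; rewrite le_max lexx ?orbT.
have hs : has_sup [set x | x = normc a \/ x = normc b].
  split; first by exists (normc a); left.
  by exists (Num.max (normc a) (normc b)) => x [] ->; rewrite le_max lexx ?orbT.
by rewrite ge_max; apply/andP; split; apply: ub_le_sup => //=;
  [exact: hs.2|left|exact: hs.2|right].
Qed.

End Modulus.

(** * The complexified cocycle *)

Section Cocycle.
Set Implicit Arguments.
Unset Strict Implicit.
Context {R : realType}.
Local Notation C := R[i].
Implicit Types (z : C) (v : 'rV[C]_2) (B : 'M[R]_2).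

Definition expi (t : R) : C := (cos t +i* sin t)%C.

Lemma normc_expi t : normc (expi t) = 1.
Proof. by rewrite /expi /= cos2Dsin2 sqrtr1. Qed.

Lemma expiD s t : expi (s + t) = expi s * expi t.
Proof.
apply/eqP; rewrite eq_complex /= cosD sinD.
by apply/andP; split; apply/eqP; ring.
Qed.

(* [crot z = z R_t] for [z = e^{it}], see [crot_expi]. *)
Definition crot z : 'M[C]_2 := \matrix_(i, j)
  if i == j then (z ^+ 2 + 1) / 2
  else if (i < j)%N then 'i%C * (z ^+ 2 - 1) / 2
  else - ('i%C * (z ^+ 2 - 1) / 2).

Definition cmx B : 'M[C]_2 := map_mx (real_complex R) B.

Lemma crot_expi t : crot (expi t) = expi t *: cmx (rotation t).
Proof.
have h x : x + x = 2 * x :> C by ring.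
(* Writing 1 as cos^2 + sin^2 turns the two Euler identities below into polynomial identities in
   [cos t] and [sin t]. *)
have one : 1 = (cos t ^+ 2 + sin t ^+ 2)%:C%C :> C by rewrite cos2Dsin2.
have E : expi t ^+ 2 + 1 = 2 * (expi t * (cos t)%:C%C).
  rewrite expr2 -h one; apply/eqP.
  by rewrite eq_complex /=; apply/andP; split; apply/eqP; ring.
have F : expi t ^+ 2 - 1 = 2 * ('i%C * (expi t * (sin t)%:C%C)).
  rewrite expr2 -h one; apply/eqP.
  by rewrite eq_complex /=; apply/andP; split; apply/eqP; ring.
have i2 := sqr_i R.
apply/matrixP => i j; rewrite !mxE E F; case: eqP => _; first by field.
case: ifP => _; rewrite ?rmorphN /=;
 (rewrite (_ : ('i)%C * _ / 2 = ('i)%C ^+ 2 * (expi t * (sin t)%:C)%C);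
   last by field);
 by rewrite i2; ring.
Qed.

Lemma det_crot z : \det (crot z) = z ^+ 2.
Proof.
rewrite det_mx2 !mxE /=.
rewrite (_ : _ - _ = ((z ^+ 2 + 1) ^+ 2 + 'i%C ^+ 2 * (z ^+ 2 - 1) ^+ 2) / 4);
  last by field.
by rewrite sqr_i; field.
Qed.

(* The oriented area spanned by the real and imaginary parts of [v], as a
   Hermitian form; it is diagonal in the coordinates [pc], [qc] (see [areaE]),
   which also diagonalize [crot z]. *)
Definition area v : R :=
  complex.Re (v 0 0) * complex.Im (v 0 1) - complex.Im (v 0 0) * complex.Re (v 0 1).

(** A real matrix acts separately on the real and imaginary parts of [v], so it scales the area they
    span by its determinant. *)
Lemma area_real v B : area (v *m cmx B) = \det B * area v.
Proof.
rewrite /area !mulmx2E !mxE det_mx2.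
case: (v 0 0) => a b; case: (v 0 1) => c d /=; ring.
Qed.

Lemma area_scale a v : area (a *: v) = normc a ^+ 2 * area v.
Proof.
rewrite sqr_normcE /area !mxE; case: a (v 0 0) (v 0 1) => a b [c d] [e f] /=; ring.
Qed.

Definition pc v := v 0 0 - 'i%C * v 0 1.
Definition qc v := v 0 0 + 'i%C * v 0 1.

Lemma areaE v : area v = (normc (pc v) ^+ 2 - normc (qc v) ^+ 2) / 4.
Proof.
rewrite /pc /qc /area !sqr_normcE; case: (v 0 0) (v 0 1) => a b [c d] /=; by field.
Qed.

Lemma pc_crot v z : pc (v *m crot z) = z ^+ 2 * pc v.
Proof.
rewrite /pc !mulmx2E !mxE /=.
have i2 := sqr_i R.
transitivity ((v 0 0 * (z ^+ 2 + 1) - 'i%C ^+ 2 * v 0 0 * (z ^+ 2 - 1) -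
  'i%C * (v 0 1 * (z ^+ 2 - 1) + v 0 1 * (z ^+ 2 + 1))) / 2); first by field.
by rewrite i2; field.
Qed.

Lemma qc_crot v z : qc (v *m crot z) = qc v.
Proof.
rewrite /qc !mulmx2E !mxE /=.
have i2 := sqr_i R.
transitivity ((v 0 0 * (z ^+ 2 + 1) + 'i%C ^+ 2 * v 0 0 * (z ^+ 2 - 1) +
  'i%C * (- v 0 1 * (z ^+ 2 - 1) + v 0 1 * (z ^+ 2 + 1))) / 2); first by field.
by rewrite i2; field.
Qed.

Lemma area_crot v z : area (v *m crot z) =
  (normc z ^+ 4 * normc (pc v) ^+ 2 - normc (qc v) ^+ 2) / 4.
Proof. by rewrite areaE pc_crot qc_crot normcM normcX; congr (_ / _); ring. Qed.

Lemma pq_eq0 v : pc v = 0 -> qc v = 0 -> v = 0.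
Proof.
rewrite /pc /qc => p0 q0.
have v0 : v 0 0 = 0.
  by rewrite (_ : v 0 0 = (v 0 0 - 'i%C * v 0 1 + (v 0 0 + 'i%C * v 0 1)) / 2);
    [rewrite p0 q0 addr0 mul0r|field].
have v1 : v 0 1 = 0.
  move: q0; rewrite v0 add0r => /eqP; rewrite mulf_eq0 => /orP[|/eqP//].
  by rewrite eq_complex /= oner_eq0 andbF.
apply/rowP => -[[|[|//]] hi]; rewrite mxE; [rewrite -[RHS]v0|rewrite -[RHS]v1];
  by congr (v _ _); apply/val_inj.
Qed.

(** The leftmost factor has index 0, so that [cprodS] matches the order in which a row vector meets
    the factors. The theorem uses it for the reversed family [A (rev_ord i)]. *)
Definition cprod n (B : 'I_n -> 'M[R]_2) z : 'M[C]_2 :=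
  \prod_(i < n) (cmx (B i) *m crot z).

Lemma cprodS n (B : 'I_n.+1 -> 'M[R]_2) z :
  cprod B z = cmx (B ord0) *m crot z *m cprod (fun i => B (lift ord0 i)) z.
Proof. by rewrite /cprod big_ord_recl. Qed.

Lemma det_cmx B : \det (cmx B) = (\det B)%:C%C.
Proof. exact: det_map_mx. Qed.

Lemma det_cprod n (B : 'I_n -> 'M[R]_2) z : (forall i, \det (B i) = 1) ->
  \det (cprod B z) = z ^+ (2 * n).
Proof.
elim: n B => [|n IH] B dB; first by rewrite /cprod big_ord0 muln0 det1.
rewrite cprodS !det_mulmx det_cmx dB det_crot IH// mul1r.
by rewrite mulnS exprD.
Qed.

(** Each [B i] preserves [area], and [crot z] multiplies its positive square by |z|^4 <= 1 while
    keeping the negative one; hence a single step bounds the new area both by the old one and by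
    |z|^4 times the old one. The factor |z|^(4n) is written as a square for comparison with |a|^2 in
    [eigen_cprod]. *)
Lemma area_cprod_le n (B : 'I_n -> 'M[R]_2) z v : (forall i, \det (B i) = 1) ->
  normc z <= 1 ->
  area (v *m cprod B z) <= area v /\
  area (v *m cprod B z) <= (normc z ^+ (2 * n)) ^+ 2 * area v.
Proof.
move=> dB z1; have z0 := normc_ge0 z.
elim: n B v dB => [|n IH] B v dB.
  by rewrite /cprod big_ord0 muln0 !expr0 expr1n mulmx1 mul1r.
rewrite cprodS !mulmxA; set w := v *m cmx (B ord0).
have Qw : area w = area v by rewrite area_real dB mul1r.
have [le1 le2] :=
  IH (fun i => B (lift ord0 i)) (w *m crot z) (fun i => dB _).
have r1 : normc z ^+ 4 <= 1 by rewrite exprn_ile1.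
have r0 : 0 <= normc z ^+ 4 by rewrite exprn_ge0.
have p0 := sqr_ge0 (normc (pc w)); have q0 := sqr_ge0 (normc (qc w)).
have h1 : area (w *m crot z) <= area w by rewrite area_crot areaE; nra.
have h2 : area (w *m crot z) <= normc z ^+ 4 * area w by rewrite area_crot areaE; nra.
split; first by rewrite -Qw; exact: le_trans le1 h1.
apply: (le_trans le2); rewrite -Qw.
apply: le_trans (ler_wpM2l (sqr_ge0 _) h2) _.
rewrite mulnS exprD (_ : (_ * _) ^+ 2 * _ =
  (normc z ^+ (2 * n)) ^+ 2 * (normc z ^+ 4 * area w)) //.
by move: (normc z ^+ (2 * n)) => u; ring.
Qed.

(** A nonzero null vector has |p| = |q| > 0 in the diagonal coordinates, so the first [crot z]
    already makes its area negative; the remaining factors cannot increase it. *)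
Lemma area_cprod_lt n (B : 'I_n -> 'M[R]_2) z v : (0 < n)%N ->
  (forall i, \det (B i) = 1) -> normc z < 1 -> v != 0 -> area v = 0 ->
  area (v *m cprod B z) < 0.
Proof.
case: n B => [//|n] B _ dB z1 v0 Q0; have z0 := normc_ge0 z.
rewrite cprodS !mulmxA; set w := v *m cmx (B ord0).
have Qw : area w = 0 by rewrite area_real dB mul1r.
have w0 : w != 0.
  apply: contra v0 => /eqP w0.
  have uB : cmx (B ord0) \in unitmx by rewrite unitmxE det_cmx dB unitr1.
  by rewrite -(mulmxK uB v) -/w w0 mul0mx.
have [le1 _] := @area_cprod_le _ (fun i => B (lift ord0 i)) z (w *m crot z)
  (fun i => dB _) (ltW z1).
apply: le_lt_trans le1 _; rewrite area_crot.
move: Qw; rewrite areaE => /eqP; rewrite mulf_eq0 invr_eq0 pnatr_eq0 orbF subr_eq0.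
move=> /eqP pq; have q0 : 0 < normc (pc w) ^+ 2.
  rewrite lt0r sqr_ge0 andbT; apply: contra w0 => /eqP p0.
  apply/eqP/pq_eq0; apply/eqP; rewrite -normc_eq0 -sqrf_eq0 -?pq p0//.
have r1 : normc z ^+ 4 < 1 by rewrite exprn_ilt1.
rewrite -pq; nra.
Qed.

(** For an eigenvector [v] the area is multiplied by |a|^2. A negative area that does not increase
    forces |a| >= 1, a positive one forces the contraction bound, and a null [v] would contradict
    strict decrease. *)
Lemma eigen_cprod n (B : 'I_n -> 'M[R]_2) z a : (0 < n)%N ->
  (forall i, \det (B i) = 1) -> normc z < 1 -> eigenvalue (cprod B z) a ->
  1 <= normc a \/ normc a <= normc z ^+ (2 * n).
Proof.
move=> n0 dB z1 /eigenvalueP[v va v0].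
have [le1 le2] := @area_cprod_le n B z v dB (ltW z1).
have := @area_cprod_lt n B z v n0 dB z1 v0.
move: le1 le2; rewrite va area_scale => le1 le2 lt0.
have a0 := normc_ge0 a.
have [Q0|Q0|Q0] := ltgtP (area v) 0.
- by left; rewrite -(@ler_pXn2r _ 2) ?nnegrE// expr1n; nra.
- right; rewrite -(@ler_pXn2r _ 2) ?nnegrE ?exprn_ge0 ?normc_ge0//.
  by rewrite -(ler_pM2r Q0).
- by have := lt0 Q0; rewrite Q0 mulr0 ltxx.
Qed.

(** The dichotomy of [eigen_cprod] must separate the two eigenvalues: the product of their moduli is
    q = |z|^(2n) with 0 < q < 1, whereas it would be at least 1 if both were large and at most q^2 <
    q if both were small. *)
Lemma cprod_spectrum n (B : 'I_n -> 'M[R]_2) z : (0 < n)%N ->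
  (forall i, \det (B i) = 1) -> 0 < normc z < 1 ->
  exists a b, [/\ \tr (cprod B z) = a + b, \det (cprod B z) = a * b,
    1 <= normc a & normc b <= normc z ^+ (2 * n)].
Proof.
move=> n0 dB /andP[z0 z1].
have [a [b [tab dab]]] := quadratic_roots (\tr (cprod B z)) (\det (cprod B z)).
have ea : eigenvalue (cprod B z) a by rewrite (eigenvalue2 tab dab) eqxx.
have eb : eigenvalue (cprod B z) b by rewrite (eigenvalue2 tab dab) eqxx orbT.
have nab : normc a * normc b = normc z ^+ (2 * n).
  by rewrite -normcM -dab det_cprod// normcX.
have q1 : normc z ^+ (2 * n) < 1.
  by rewrite exprn_ilt1 ?normc_ge0// muln_eq0 -lt0n n0.
have q0 : 0 < normc z ^+ (2 * n) by rewrite exprn_gt0.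
have a0 := normc_ge0 a; have b0 := normc_ge0 b.
have [ha|ha] := @eigen_cprod n B z a n0 dB z1 ea;
  have [hb|hb] := @eigen_cprod n B z b n0 dB z1 eb.
- exfalso; move: nab q1; set q := (_ ^+ _); nra.
- by exists a, b.
- by exists b, a; rewrite addrC mulrC.
- exfalso; move: nab q1 q0 ha hb; set q := (_ ^+ _); nra.
Qed.

(** On the unit circle the determinant has modulus 1, so the two moduli cannot both be below 1. *)
Lemma cprod_spectrum1 n (B : 'I_n -> 'M[R]_2) z a b :
  (forall i, \det (B i) = 1) -> normc z = 1 -> \det (cprod B z) = a * b ->
  1 <= Num.max (normc a) (normc b).
Proof.
move=> dB z1 dab; rewrite leNgt gt_max; apply/negP => /andP[a1 b1].
have := normcX z (2 * n); rewrite -(det_cprod z dB) dab normcM z1 expr1n.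
have a0 := normc_ge0 a; have b0 := normc_ge0 b; nra.
Qed.

End Cocycle.

(** * The trace of the cocycle *)

Section Trace.
Set Implicit Arguments.
Unset Strict Implicit.
Context {R : realType}.
Local Notation C := R[i].
Implicit Types (z : C) (B : 'M[R]_2).

(** This is the trace of [cmx B *m crot 0]. For [B] of determinant 1 its modulus is the exponential
    of [logN B], see [logN_alpha]. *)
Definition alpha B : C := ((B 0 0 + B 1 1) +i* (B 0 1 - B 1 0))%C / 2.

(** Twice [crot 0], free of denominators so that [ring] applies to real and imaginary parts. *)
Definition crot02 : 'M[C]_2 := \matrix_(i, j)
  if i == j then 1 else if (i < j)%N then - 'i%C else 'i%C.

Lemma crot0E : crot 0 = 2^-1 *: crot02.
Proof.
apply/matrixP => i j; rewrite !mxE expr0n /= add0r sub0r.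
by case: eqP => _; [rewrite mul1r mulr1|case: ifP => _; field].
Qed.

Lemma crot02_mul B :
  crot02 *m cmx B *m crot02 = ((B 0 0 + B 1 1) +i* (B 0 1 - B 1 0))%C *: crot02.
Proof.
apply/matrixP => -[[|[|//]] hi] -[[|[|//]] hj]; rewrite !mulmx2E !mxE /=;
  apply/eqP; rewrite eq_complex /=; apply/andP; split; apply/eqP; ring.
Qed.

(** The matrix P = [crot 0] is a projection of rank one, so P X P is the trace of X P times P. *)
Lemma crot0_mul B : crot 0 *m (cmx B *m crot 0) = alpha B *: crot 0.
Proof.
rewrite crot0E mulmxA -!scalemxAl -!scalemxAr crot02_mul.
by rewrite !scalerA /alpha; congr (_ *: _); ring.
Qed.

Lemma trace_crot0 B : \tr (cmx B *m crot 0) = alpha B.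
Proof.
rewrite crot0E -scalemxAr mxtraceZ mxtrace2 !mulmx2E !mxE /= mulrC /alpha.
by congr (_ / _); apply/eqP; rewrite eq_complex /=; apply/andP; split; apply/eqP; ring.
Qed.

(** The extra [crot 0] on the left places every [B i] between two copies of the projection, and the
    product collapses to scalars. *)
Lemma crot0_cprod n (B : 'I_n -> 'M[R]_2) :
  crot 0 *m cprod B 0 = (\prod_(i < n) alpha (B i)) *: crot 0.
Proof.
elim: n B => [|n IH] B; first by rewrite /cprod !big_ord0 mulmx1 scale1r.
by rewrite cprodS !mulmxA -[_ *m cmx _ *m _]mulmxA crot0_mul -scalemxAl IH
  big_ord_recl scalerA.
Qed.

Lemma trace_cprod0 n (B : 'I_n -> 'M[R]_2) : (0 < n)%N ->
  \tr (cprod B 0) = \prod_(i < n) alpha (B i).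
Proof.
case: n B => [//|n] B _; rewrite cprodS -mulmxA crot0_cprod -scalemxAr.
by rewrite mxtraceZ trace_crot0 big_ord_recl mulrC.
Qed.

Lemma sqr_normc_alpha B : normc (alpha B) ^+ 2 =
  ((B 0 0 + B 1 1) ^+ 2 + (B 0 1 - B 1 0) ^+ 2) / 4.
Proof.
have n2 : normc (2 : C) = 2.
  by rewrite -(rmorph_nat (real_complex R) 2) normc_real ger0_norm.
by rewrite /alpha normcM normcV n2 exprMn sqr_normcE /=; field.
Qed.

(** * The Euclidean operator norm in SL(2, R) and its link with [alpha] *)

Lemma sumsqr2 (v : 'cV[R]_2) :
  \sum_(i < 2) v i 0 ^+ 2 = v 0 0 ^+ 2 + v 1 0 ^+ 2.
Proof.
by rewrite big_ord_recl big_ord1; congr (_ + v _ _ ^+ _); apply/val_inj.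
Qed.

(* The square of the norm is the largest eigenvalue of [B^T B]. *)
Lemma sqr_opnorm B : \det B = 1 ->
  let h := (B 0 0 ^+ 2 + B 0 1 ^+ 2 + B 1 0 ^+ 2 + B 1 1 ^+ 2) / 2 in
  opnorm B = Num.sqrt (h + Num.sqrt (h ^+ 2 - 1)) /\ 1 <= h.
Proof.
move Ba: (B 0 0) => a; move Bb: (B 0 1) => b.
move Bc: (B 1 0) => c; move Bd: (B 1 1) => d.
rewrite det_mx2 Ba Bb Bc Bd => det1 h.
have h1 : 1 <= h.
  have := sqr_ge0 (a - d); have := sqr_ge0 (b + c); rewrite /h; nra.
split => //; set w := Num.sqrt (h ^+ 2 - 1); set l := h + w.
have w0 : 0 <= w by rewrite sqrtr_ge0.
have w2 : w ^+ 2 = h ^+ 2 - 1 by rewrite sqr_sqrtr// subr_ge0; nra.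
(* These are the entries of B^T B, of trace [2 * h] and determinant 1; [pq] below says that [l] is a
   root of its characteristic polynomial. *)
pose e := a ^+ 2 + c ^+ 2; pose g := b ^+ 2 + d ^+ 2; pose f := a * b + c * d.
have eg : e + g = 2 * h by rewrite /e /g /h; field.
have egf : e * g - f ^+ 2 = 1.
  have -> : e * g - f ^+ 2 = (a * d - b * c) ^+ 2 by rewrite /e /g /f; ring.
  by rewrite det1 expr1n.
have pq : (l - e) * (l - g) = f ^+ 2.
  rewrite (_ : _ * _ = l ^+ 2 - (e + g) * l + e * g); last by ring.
  by rewrite eg /l; nra.
have l0 : 0 < l by rewrite /l; lra.
(* The two numbers have a nonnegative sum [2 * w] and a nonnegative product [f ^+ 2]. *)
have [p0 q0] : 0 <= l - e /\ 0 <= l - g.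
  have sge : 0 <= (l - e) + (l - g) by rewrite /l; lra.
  have f0 := sqr_ge0 f.
  by split; rewrite leNgt; apply/negP => lt0; nra.
have BvE (v : 'cV[R]_2) : enorm (B *m v) =
    Num.sqrt (e * v 0 0 ^+ 2 + 2 * f * v 0 0 * v 1 0 + g * v 1 0 ^+ 2).
  rewrite /enorm sumsqr2 !mulmx2E Ba Bb Bc Bd; congr Num.sqrt.
  by rewrite /e /f /g; ring.
have vE (v : 'cV[R]_2) : enorm v = Num.sqrt (v 0 0 ^+ 2 + v 1 0 ^+ 2).
  by rewrite /enorm sumsqr2.
have v0 (v : 'cV[R]_2) : v != 0 -> 0 < v 0 0 ^+ 2 + v 1 0 ^+ 2.
  move=> v0; rewrite lt0r addr_ge0 ?sqr_ge0// andbT; apply: contra v0.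
  rewrite paddr_eq0 ?sqr_ge0// !sqrf_eq0 => /andP[/eqP x0 /eqP y0].
  apply/eqP/colP => -[[|[|//]] hi]; rewrite mxE; [rewrite -[RHS]x0|rewrite -[RHS]y0];
  by congr (v _ _); apply/val_inj.
have ub (v : 'cV[R]_2) : v != 0 -> enorm (B *m v) / enorm v <= Num.sqrt l.
  move=> /v0 v1; rewrite BvE vE ler_pdivrMr ?sqrtr_gt0// -(sqrtrM _ (ltW l0)).
  apply: ler_wsqrtr.
  move: (v 0 0) (v 1 0) => x y.
  have [pe0|pn0] := eqVneq (l - e) 0.
    have f0 : f = 0 by apply/eqP; rewrite -sqrf_eq0 -pq pe0 mul0r.
    have := mulr_ge0 q0 (sqr_ge0 y); rewrite f0; nra.
  (* After multiplication by [l - e] > 0, the difference of the two sides is a perfect square,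
     thanks to [pq]. *)
  rewrite -subr_ge0 -(@pmulr_rge0 _ (l - e)); last by rewrite lt0r pn0.
  have -> : (l - e) * (l * (x ^+ 2 + y ^+ 2) -
      (e * x ^+ 2 + 2 * f * x * y + g * y ^+ 2)) =
    ((l - e) * x - f * y) ^+ 2 + ((l - e) * (l - g) - f ^+ 2) * y ^+ 2 by ring.
  by rewrite pq subrr mul0r addr0 sqr_ge0.
have [v vn0 vl] : exists2 v : 'cV[R]_2, v != 0 & enorm (B *m v) / enorm v = Num.sqrt l.
  suff [x [y [xy0 xyl]]] : exists x y : R, 0 < x ^+ 2 + y ^+ 2 /\
      e * x ^+ 2 + 2 * f * x * y + g * y ^+ 2 = l * (x ^+ 2 + y ^+ 2).
    pose v : 'cV[R]_2 := \col_i if i == 0 then x else y.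
    have vx : v 0 0 = x by rewrite mxE.
    have vy : v 1 0 = y by rewrite mxE.
    exists v.
      apply/negP => /eqP vz; move: xy0.
      by rewrite -vx -vy vz !mxE !expr0n addr0 ltxx.
    by rewrite BvE vE vx vy xyl (sqrtrM _ (ltW l0)) mulfK// gt_eqF// sqrtr_gt0.
  (* The vector (f, l - e) is an eigenvector of B^T B for [l]. If [l = e] then [f = 0] and this
     vector vanishes, but B^T B is diagonal and (1, 0) serves instead. *)
  have [pe0|pn0] := eqVneq (l - e) 0.
    have f0 : f = 0 by apply/eqP; rewrite -sqrf_eq0 -pq pe0 mul0r.
    exists 1, 0; split; first by rewrite expr1n expr0n addr0 ltr01.
    by rewrite -(subrK e l) pe0; ring.
  exists f, (l - e); split.
    by rewrite ltr_wpDl ?sqr_ge0// lt0r sqrf_eq0 pn0 sqr_ge0.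
  apply/eqP; rewrite -subr_eq0.
  have -> : e * f ^+ 2 + 2 * f * f * (l - e) + g * (l - e) ^+ 2 -
    l * (f ^+ 2 + (l - e) ^+ 2) = (l - e) * (f ^+ 2 - (l - e) * (l - g)) by ring.
  by rewrite pq subrr mulr0.
apply/eqP; rewrite eq_le /opnorm; apply/andP; split.
  apply: ge_sup; first by exists (enorm (B *m v) / enorm v), v.
  by move=> _ [u u0 <-]; exact: ub.
rewrite -vl; apply: ub_le_sup; last by exists v.
by exists (Num.sqrt l) => _ [u u0 <-]; exact: ub.
Qed.

(** With s the operator norm, s^2 = h + w and s^-2 = h - w, so ((s + 1/s) / 2)^2 = (h + 1) / 2.
    Expanding |alpha|^2 with ad - bc = 1 gives the same value. *)
Lemma logN_alpha B : \det B = 1 -> logN B = ln (normc (alpha B)) /\ 0 < normc (alpha B).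
Proof.
move=> dB; have [] := sqr_opnorm dB; have := sqr_normc_alpha B.
move: dB; rewrite det_mx2 => dB aE; set h := (_ / 2); set w := Num.sqrt (h ^+ 2 - 1).
move=> oE h1; rewrite /logN oE.
have w0 : 0 <= w by rewrite sqrtr_ge0.
have w2 : w ^+ 2 = h ^+ 2 - 1 by rewrite sqr_sqrtr// subr_ge0; nra.
have a2 : normc (alpha B) ^+ 2 = (h + 1) / 2.
  rewrite aE -[X in _ = (h + X) / 2]dB /h; by field.
have a0 : 0 < normc (alpha B).
  by rewrite lt0r normc_ge0 andbT -sqrf_eq0 a2; apply/eqP => ?; nra.
split=> //; congr ln; apply/eqP.
have l0 : 0 < h + w by lra.
set s := Num.sqrt (h + w).
have s0 : 0 < s by rewrite sqrtr_gt0.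
have s2 : s ^+ 2 = h + w by rewrite sqr_sqrtr// ltW.
rewrite -(@eqrXn2 _ 2)//; last 2 first.
- by rewrite divr_ge0// addr_ge0 ?invr_ge0// ltW.
- exact: ltW.
have hw : (h + w)^-1 = h - w.
  apply: (mulfI (x := h + w)); first by rewrite gt_eqF.
  by rewrite mulfV ?gt_eqF//; nra.
have sn0 : s != 0 by rewrite gt_eqF.
have -> : ((s + s^-1) / 2) ^+ 2 = (s ^+ 2 + (s ^+ 2)^-1 + 2) / 4 by field.
by rewrite a2 s2 hw; apply/eqP; field.
Qed.

(** * Traces and power sums of eigenvalues as polynomials in z *)

Lemma trace_poly n (B : 'I_n -> 'M[R]_2) :
  exists T : {poly C}, forall z, T.[z] = \tr (cprod B z).
Proof.
have crotp i j : exists P : {poly C}, forall z, P.[z] = crot z i j.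
  exists (if i == j then 2^-1 *: ('X ^+ 2 + 1) else
    if (i < j)%N then ('i%C / 2) *: ('X ^+ 2 - 1) else (- ('i%C / 2)) *: ('X ^+ 2 - 1)).
  by move=> z; rewrite mxE; case: ifP => _; [|case: ifP => _]; rewrite !hornerE; field.
suff H : forall i j, exists P : {poly C}, forall z, P.[z] = cprod B z i j.
  have [P hP] := H 0 0; have [Q hQ] := H 1 1.
  by exists (P + Q) => z; rewrite hornerD hP hQ mxtrace2.
elim: n B => [|n IH] B i j.
  by exists ((i == j)%:R)%:P => z; rewrite /cprod big_ord0 hornerC mxE.
have H1 k : exists P : {poly C}, forall z, P.[z] = (cmx (B ord0) *m crot z) i k.
  have [P hP] := crotp 0 k; have [Q hQ] := crotp 1 k.
  exists (cmx (B ord0) i 0 *: P + cmx (B ord0) i 1 *: Q) => z.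
  by rewrite mulmx2E !hornerE hP hQ.
have [P0 h0] := H1 0; have [P1 h1] := H1 1.
have [Q0 g0] := IH (fun i => B (lift ord0 i)) 0 j.
have [Q1 g1] := IH (fun i => B (lift ord0 i)) 1 j.
exists (P0 * Q0 + P1 * Q1) => z.
by rewrite cprodS mulmx2E !hornerE h0 h1 g0 g1.
Qed.

(** Newton's recursion s_(k+2) = T s_(k+1) - D s_k, carried for two consecutive exponents. Applied
    to the trace and determinant of a matrix, it gives the trace of the k-th power. *)
Lemma power_sum_poly (T D : {poly C}) k : exists P : {poly C}, forall z a b,
  T.[z] = a + b -> D.[z] = a * b -> P.[z] = a ^+ k + b ^+ k.
Proof.
suff [P [Q [hP _]]] : exists P Q : {poly C},
  (forall z a b, T.[z] = a + b -> D.[z] = a * b -> P.[z] = a ^+ k + b ^+ k) /\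
  (forall z a b, T.[z] = a + b -> D.[z] = a * b -> Q.[z] = a ^+ k.+1 + b ^+ k.+1).
  by exists P.
elim: k => [|k [P [Q [hP hQ]]]].
  exists 2%:P, T; split=> z a b Tz Dz; first by rewrite hornerC !expr0.
  by rewrite !expr1.
exists Q, (T * Q - D * P); split=> // z a b Tz Dz.
rewrite !hornerE (hP _ _ _ Tz Dz) (hQ _ _ _ Tz Dz) Tz Dz !exprS; ring.
Qed.

Lemma cprod_expi n (A : 'I_n -> 'M[R]_2) t :
  cprod (fun i => A (rev_ord i)) (expi t) = expi t ^+ n *: cmx (rotprod A t).
Proof.
(* The family is generalized because reversal of indices does not commute with peeling off the first
   factor. *)
suff H (F : 'I_n -> 'M[R]_2) : cprod F (expi t) =
    expi t ^+ n *: cmx (\prod_(i < n) (F i *m rotation t)) by rewrite H.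
elim: n {A} F => [|n IH] F.
  by rewrite /cprod !big_ord0 expr0 scale1r /cmx map_mx1.
rewrite cprodS IH big_ord_recl crot_expi -!scalemxAr -scalemxAl.
by rewrite scalerA exprSr /cmx -!map_mxM.
Qed.

Lemma specrad_rotprod n (A : 'I_n -> 'M[R]_2) t :
  specrad (rotprod A t) = rad (\tr (cprod (fun i => A (rev_ord i)) (expi t)))
    (\det (cprod (fun i => A (rev_ord i)) (expi t))).
Proof.
rewrite specrad2 cprod_expi mxtraceZ detZ -(@rad_unit _ (expi t ^+ n)).
  by rewrite /cmx trace_map_mx det_map_mx.
by rewrite normcX normc_expi expr1n.
Qed.

End Trace.

(** * Integrals over the circle *)

Section Circle.
Set Implicit Arguments.
Unset Strict Implicit.
Context {R : realType}.
Local Notation C := R[i].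
Local Notation mu := (@lebesgue_measure R).
Implicit Types (f g : R -> R).

(** Turns an estimate with an error independent of [k] into an equality. *)
Lemma archi_bounded0 (x K : R) : (forall k : nat, k%:R * `|x| <= K) -> x = 0.
Proof.
move=> H; apply/eqP; rewrite -normr_le0 leNgt; apply/negP => x0.
have K0 : 0 <= K by have := H 0%N; rewrite mul0r.
have := archi_boundP (divr_ge0 K0 (ltW x0)).
by rewrite ltr_pdivrMr// ltNge H.
Qed.

(** The modulus lies between 1 - s and 1 + s, and 1 + s <= 1 / (1 - s) because (1 + s)(1 - s) <=
    1. *)
Lemma ln_normc1D_bound (u : C) (s : R) : normc u <= s -> s < 1 ->
  `|ln (normc (1 + u))| <= - ln (1 - s).
Proof.
move=> us s1; have u0 := normc_ge0 u.
have lb : 1 - s <= normc (1 + u).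
  by have := normcD_ge 1 u; rewrite normc1; lra.
have ub : normc (1 + u) <= 1 + s.
  by have := le_normcD 1 u; rewrite normc1; lra.
have s0 : 0 < 1 - s by rewrite subr_gt0.
rewrite ler_norml opprK; apply/andP; split.
  by rewrite ler_ln ?posrE//; lra.
rewrite -lnV ?posrE// ler_ln ?posrE ?invr_gt0//; last by lra.
apply: (le_trans ub); rewrite -[leRHS]mul1r ler_pdivlMr//; nra.
Qed.

Section Limits.
Context {T : Type} {F : set_system T} {FF : Filter F}.

(** Convergence is expressed on real and imaginary parts, so that only limits of real functions are
    involved. *)
Lemma cvg_horner (P : {poly C}) (x y : T -> R) x0 y0 :
  x @ F --> x0 -> y @ F --> y0 ->
  ((fun t => complex.Re P.[(x t +i* y t)%C]) @ F --> complex.Re P.[(x0 +i* y0)%C]) /\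
  ((fun t => complex.Im P.[(x t +i* y t)%C]) @ F --> complex.Im P.[(x0 +i* y0)%C]).
Proof.
move=> hx hy; elim/poly_ind: P => [|P c [IHr IHi]].
  by rewrite horner0; split; under eq_fun do rewrite horner0; exact: cvg_cst.
have Re w : complex.Re (P * 'X + c%:P).[w] =
    complex.Re P.[w] * complex.Re w - complex.Im P.[w] * complex.Im w + complex.Re c.
  by rewrite !hornerE; case: (P.[w]) => u v; case: w => ? ?; case: (c).
have Im w : complex.Im (P * 'X + c%:P).[w] =
    complex.Re P.[w] * complex.Im w + complex.Im P.[w] * complex.Re w + complex.Im c.
  by rewrite !hornerE; case: (P.[w]) => u v; case: w => ? ?; case: (c).
rewrite Re Im; split.
  under eq_fun do rewrite Re.
  by apply: cvgD; [apply: cvgB; exact: cvgM|exact: cvg_cst].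
under eq_fun do rewrite Im.
by apply: cvgD; [apply: cvgD; exact: cvgM|exact: cvg_cst].
Qed.

Lemma cvg_normc_horner (P : {poly C}) (x y : T -> R) x0 y0 :
  x @ F --> x0 -> y @ F --> y0 ->
  (fun t => normc P.[(x t +i* y t)%C]) @ F --> normc P.[(x0 +i* y0)%C].
Proof.
move=> hx hy; have [hr hi] := cvg_horner P hx hy.
rewrite normcE_sqrt; under eq_fun do rewrite normcE_sqrt.
apply: cvg_comp; last exact: sqrt_continuous.
by rewrite !expr2; apply: cvgD; exact: cvgM.
Qed.

Lemma cvg_rad_horner (P D : {poly C}) (x y : T -> R) x0 y0 :
  x @ F --> x0 -> y @ F --> y0 ->
  (fun t => rad P.[(x t +i* y t)%C] D.[(x t +i* y t)%C]) @ F -->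
  rad P.[(x0 +i* y0)%C] D.[(x0 +i* y0)%C].
Proof.
move=> hx hy.
have E w : P.[w] ^+ 2 - 4 * D.[w] = (P ^+ 2 - 4%:P * D).[w].
  by rewrite !hornerE.
have hP := cvg_normc_horner (P := P) hx hy; have hD := cvg_normc_horner (P := D) hx hy.
have hE := cvg_normc_horner (P := P ^+ 2 - 4%:P * D) hx hy.
rewrite /rad E; under eq_fun do rewrite E.
apply: cvgMr_tmp; apply: cvgD; (apply: cvg_comp; last exact: sqrt_continuous).
- apply: cvgD; last exact: cvgMl_tmp.
  by apply: cvgMr_tmp; rewrite expr2; apply: cvgD => //; exact: cvgM.
- apply: cvgB; last exact: cvgMl_tmp.
  by apply: cvgMr_tmp; rewrite expr2; apply: cvgD => //; exact: cvgM.
Qed.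

End Limits.

Lemma scaled_expi (r t : R) : r%:C%C * expi t = (r * cos t +i* (r * sin t))%C.
Proof.
by apply/eqP; rewrite eq_complex /= !mul0r subr0 addr0 !eqxx.
Qed.

Lemma continuous_ln_normc (P : {poly C}) (r : R) :
  (forall t, P.[r%:C%C * expi t] != 0) ->
  continuous (fun t => ln (normc P.[r%:C%C * expi t])).
Proof.
move=> P0 t; apply: (@continuous_comp _ _ _ (fun t => normc P.[r%:C%C * expi t]) (@ln R)).
  rewrite /prop_for /continuous_at scaled_expi; under eq_fun do rewrite scaled_expi.
  apply: cvg_normc_horner; apply: cvgMl_tmp; [exact: continuous_cos|exact: continuous_sin].
by apply: continuous_ln; rewrite normc_gt0.
Qed.

Lemma continuous_ln_rad (P D : {poly C}) (r : R) :
  (forall t, 0 < rad P.[r%:C%C * expi t] D.[r%:C%C * expi t]) ->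
  continuous (fun t => ln (rad P.[r%:C%C * expi t] D.[r%:C%C * expi t])).
Proof.
move=> P0 t; apply: (@continuous_comp _ _ _
  (fun t => rad P.[r%:C%C * expi t] D.[r%:C%C * expi t]) (@ln R)).
  rewrite /prop_for /continuous_at scaled_expi; under eq_fun do rewrite scaled_expi.
  apply: cvg_rad_horner; apply: cvgMl_tmp; [exact: continuous_cos|exact: continuous_sin].
by apply: continuous_ln.
Qed.

(** * Integrals of continuous functions over a period *)

Lemma continuous_integrable f a b : continuous f -> mu.-integrable `[a, b] (EFin \o f).
Proof.
move=> cf; apply: continuous_compact_integrable; first exact: segment_compact.
exact: continuous_subspaceT.
Qed.

Definition circint f : R := \int[mu]_(t in `[0, 2 * pi]) f t.

Lemma twopi_gt0 : 0 < 2 * pi :> R.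
Proof. by rewrite mulr_gt0// pi_gt0. Qed.

Lemma circint_cst c : circint (fun=> c) = 2 * pi * c.
Proof.
have := @lebesgue_measure_itv R `[0, 2 * pi].
rewrite /= lte_fin twopi_gt0 -EFinB subr0 => muE.
by rewrite /circint Rintegral_cst//= muE mulrC.
Qed.

Lemma circintD f g : continuous f -> continuous g ->
  circint (fun t => f t + g t) = circint f + circint g.
Proof. by move=> cf cg; apply: RintegralD => //; exact: continuous_integrable. Qed.

Lemma circintZ c f : continuous f -> circint (fun t => c * f t) = c * circint f.
Proof. by move=> cf; apply: RintegralZl => //; exact: continuous_integrable. Qed.

Lemma circint_bound f M : continuous f -> (forall t, `|f t| <= M) ->
  `|circint f| <= 2 * pi * M.
Proof.
move=> cf fM; rewrite -circint_cst.
apply: le_trans (le_normr_Rintegral _ (continuous_integrable _ _ cf)) _ => //.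
apply: le_Rintegral => //.
- apply: continuous_integrable => t.
  apply: (@continuous_comp _ _ _ f (fun x => `|x|)); first exact: cf.
  exact: norm_continuous.
- by apply: continuous_integrable => t; exact: cst_continuous.
Qed.

Lemma Rintegral_shift f a b c : a <= b -> continuous f ->
  \int[mu]_(t in `[a, b]) f (t + c) = \int[mu]_(t in `[a + c, b + c]) f t.
Proof.
move=> ab cf; rewrite /Rintegral; congr fine.
have d1 (x : R) : is_derive x (1:R) (fun t => t + c) 1.
  by rewrite -[X in is_derive _ _ _ X]addr0; apply: is_deriveD.
have dE : derive1 (fun t : R => t + c) = cst 1.
  by apply/funext => x; rewrite derive1E derive_val.
rewrite (@integration_by_substitution_increasing _ (fun t => t + c) f a b) //.
- by apply: eq_integral => x _; rewrite dE /= mulr1.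
- by move=> x y _ _ xy; rewrite ltrD2r.
- by move=> x _; rewrite dE; exact: cst_continuous.
- by rewrite dE; exact: is_cvg_cst.
- by rewrite dE; exact: is_cvg_cst.
- split.
  + by move=> x _; exact: ex_derive.
  + by apply: cvg_at_right_filter; apply: cvgD; [exact: cvg_id|exact: cvg_cst].
  + by apply: cvg_at_left_filter; apply: cvgD; [exact: cvg_id|exact: cvg_cst].
- exact: continuous_subspaceT.
Qed.

Lemma Rintegral_chasles f a b c : a <= b -> b <= c -> continuous f ->
  \int[mu]_(t in `[a, c]) f t =
  \int[mu]_(t in `[a, b]) f t + \int[mu]_(t in `[b, c]) f t.
Proof.
move=> ab bc cf; apply/eqP; rewrite addrC -subr_eq; apply/eqP.
rewrite Rintegral_itvB ?bnd_simp//; last exact: continuous_integrable.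
rewrite Rintegral_itv_obnd_cbnd//.
apply: integrableS (continuous_integrable b c cf) => //.
exact: subset_itv_oc_cc.
Qed.

Lemma circint_shift f c : continuous f -> (forall t, f (t + 2 * pi) = f t) ->
  0 <= c -> circint (fun t => f (t + c)) = circint f.
Proof.
move=> cf pf c0; have p0 := ltW twopi_gt0.
rewrite /circint Rintegral_shift// add0r.
(* With the integral over [0, c] added, both sides become the integral over [0, 2 pi + c]; on the
   last piece [2 pi, 2 pi + c] periodicity leads back to [0, c]. *)
apply: (addrI (\int[mu]_(t in `[0, c]) f t)).
rewrite -Rintegral_chasles//; last by rewrite lerDr.
rewrite (@Rintegral_chasles _ 0 (2 * pi) (2 * pi + c))//; last by rewrite lerDl.
rewrite addrC; congr (_ + _).
have := @Rintegral_shift f 0 c (2 * pi) c0 cf.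
rewrite add0r [c + _]addrC => <-.
by apply: eq_Rintegral => t _; rewrite pf.
Qed.

End Circle.

(** * Mean value property *)

Section Mean.
Set Implicit Arguments.
Unset Strict Implicit.
Context {R : realType}.
Local Notation C := R[i].
Local Notation mu := (@lebesgue_measure R).

Lemma expi2pi t : expi (t + 2 * pi) = expi t :> C.
Proof. by rewrite mulrC mulr_natr /expi sinD2pi cosD2pi. Qed.

Lemma expiMn (t : R) n : expi t ^+ n = expi (n%:R * t).
Proof.
elim: n => [|n IH]; last by rewrite exprS IH -expiD -natr1 mulrDl mul1r addrC.
by rewrite mul0r expr0 /expi cos0 sin0.
Qed.

Lemma expi_piV t n : (0 < n)%N -> expi (t + pi / n%:R) ^+ n = - expi t ^+ n :> C.
Proof.
move=> n0; rewrite expiD exprMn [X in _ * X]expiMn [n%:R * _]mulrC.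
rewrite divfK ?pnatr_eq0 -?lt0n// (_ : expi pi = -1) ?mulrN1//.
by apply/eqP; rewrite eq_complex /= cospi sinpi oppr0 !eqxx.
Qed.

(* Doubling: the integrals [J N] of [ln |1 - (a e^{it})^N|] satisfy
   [J (2 N) = 2 J N] but are bounded. *)
Lemma circint_ln_normc1B (a : C) : normc a < 1 ->
  circint (fun t => ln (normc (1 - a * expi t))) = 0.
Proof.
move=> a1; set s := normc a.
pose G N (t : R) := ln (normc (1 - a ^+ N * expi t ^+ N)).
have s0 : 0 <= s := normc_ge0 a.
have s1 : s < 1 := a1.
have nG N t : (0 < N)%N -> normc (- (a ^+ N * expi t ^+ N)) <= s.
  move=> N0; rewrite normcN normcM !normcX normc_expi expr1n mulr1.
  by rewrite -[leRHS]expr1 ler_wiXn2l// ltW.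
have nG' N t : (0 < N)%N -> 0 < normc (1 - a ^+ N * expi t ^+ N).
  move=> N0; have := normcD_ge 1 (- (a ^+ N * expi t ^+ N)).
  by rewrite normc1; have := nG N t N0; lra.
have cG N : (0 < N)%N -> continuous (G N).
  move=> N0.
  have E t : 1 - a ^+ N * expi t ^+ N = (1 - (a ^+ N) *: 'X^N).[1%:C%C * expi t].
    by rewrite !hornerE.
  rewrite /G; under eq_fun do rewrite E.
  by apply: continuous_ln_normc => t; rewrite -normc_gt0 -E nG'.
have bG N : (0 < N)%N -> `|circint (G N)| <= 2 * pi * - ln (1 - s).
  move=> N0; apply: circint_bound; first exact: cG.
  by move=> t; apply: ln_normc1D_bound => //; exact: nG.
(* With x = (a e^{it})^N, factor 1 - x^2 = (1 - x)(1 + x). Shifting [t] by pi / N changes the sign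
   of x, so both factors have the same integral. *)
have dG N : (0 < N)%N -> circint (G (N * 2)%N) = 2 * circint (G N).
  move=> N0; have pN : 0 <= pi / N%:R :> R by rewrite divr_ge0// ltW// pi_gt0.
  have pG t : G N (t + 2 * pi) = G N t by rewrite /G expi2pi.
  have cGs : continuous (fun t => G N (t + pi / N%:R)).
    move=> t; apply: (@continuous_comp _ _ _ (fun t => t + pi / N%:R) (G N)); last exact: cG.
    by apply: cvgD; [exact: cvg_id|exact: cvg_cst].
  have addE := circintD (cG N N0) cGs.
  rewrite [X in _ = _ + X](circint_shift (cG N N0) pG pN) in addE.
  rewrite (_ : 2 * circint (G N) = circint (G N) + circint (G N)); last first.
    by move: (circint _) => x; ring.
  rewrite -addE; congr circint; apply/funext => t; rewrite /G expi_piV//.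
  have nn : 0 < normc (1 - a ^+ N * - expi t ^+ N) by rewrite -expi_piV// nG'.
  rewrite -lnM ?posrE ?nG'//; congr ln; rewrite -normcM !exprM; congr normc; ring.
have J m : circint (G (2 ^ m)%N) = (2 ^ m)%N%:R * circint (G 1%N).
  elim: m => [|m IH]; first by rewrite mul1r.
  by rewrite expnSr dG ?expn_gt0// IH natrM mulrA [2 * _]mulrC.
have -> : (fun t => ln (normc (1 - a * expi t))) = G 1%N by [].
apply: (@archi_bounded0 _ _ (2 * pi * - ln (1 - s))) => k.
apply: le_trans (bG (2 ^ k)%N _); last by rewrite expn_gt0.
rewrite J normrM ger0_norm ?ler0n// ler_wpM2r// ler_nat.
exact/ltnW/ltn_expl.
Qed.

(** All roots have modulus at least 1, so each factor w - z equals -z (1 - w / z), where w / z has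
    modulus below 1 on the circle. The second factor contributes 0 by [circint_ln_normc1B], leaving
    ln |z|, the value of the factor at w = 0. *)
Lemma circint_ln_normc_poly (P : {poly C}) (r : R) : 0 <= r < 1 ->
  (forall z, normc z < 1 -> P.[z] != 0) ->
  circint (fun t => ln (normc P.[r%:C%C * expi t])) = 2 * pi * ln (normc P.[0]).
Proof.
move=> /andP[r0 r1] P0.
have re1 t : normc (r%:C%C * expi t) < 1.
  by rewrite normcM normc_expi mulr1 normc_real ger0_norm.
have [rs Prs] := closed_field_poly_normal P.
have c0 : lead_coef P != 0.
  by rewrite lead_coef_eq0; apply: contraNneq (P0 0 _) => [->|]; rewrite ?horner0// normc0.
have rs1 : {in rs, forall z, 1 <= normc z}.
  move=> z zrs; rewrite leNgt; apply/negP => /P0.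
  by rewrite Prs hornerZ mulf_eq0 negb_or -rootE root_prod_XsubC zrs andbF.
rewrite Prs; move: (lead_coef P) c0 => c c0 {P P0 Prs}.
have hE s w : (c *: \prod_(z <- s) ('X - z%:P)).[w] = c * \prod_(z <- s) (w - z).
  by rewrite hornerZ horner_prod; congr (_ * _); apply: eq_bigr => z _; rewrite !hornerE.
have n0 s w : {in s, forall z, 1 <= normc z} -> normc w < 1 ->
    (c *: \prod_(z <- s) ('X - z%:P)).[w] != 0.
  move=> s1 w1; rewrite hornerZ mulf_eq0 negb_or c0 -rootE root_prod_XsubC.
  by apply: contraTN w1 => /s1; rewrite -leNgt.
elim: rs rs1 => [|z s IH] s1.
  under eq_fun do rewrite hE big_nil mulr1.
  by rewrite circint_cst hE big_nil mulr1.
have s1' : {in s, forall z, 1 <= normc z}.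
  by move=> y ys; apply: s1; rewrite inE ys orbT.
have z1 : 1 <= normc z by apply: s1; rewrite mem_head.
have z0 : 0 < normc z by apply: lt_le_trans z1.
have zn0 : z != 0 by rewrite -normc_gt0.
set Q := c *: \prod_(y <- s) ('X - y%:P).
have QE w : (c *: \prod_(y <- z :: s) ('X - y%:P)).[w] = (w - z) * Q.[w].
  by rewrite /Q !hE big_cons mulrCA.
pose a := z^-1 * r%:C%C.
have a1 : normc a < 1.
  rewrite normcM normcV normc_real ger0_norm// -(@ltr_pM2l _ (normc z))//.
  by rewrite mulVKf ?gt_eqF// mulr1; lra.
have ae1 t : 1 - a * expi t != 0.
  rewrite -normc_gt0; have := normcD_ge 1 (- (a * expi t)).
  by rewrite normc1 normcN normcM normc_expi mulr1; lra.
have EP t : ln (normc ((r%:C%C * expi t - z) * Q.[r%:C%C * expi t])) =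
    ln (normc z) + ln (normc (1 - a * expi t)) + ln (normc Q.[r%:C%C * expi t]).
  have -> : r%:C%C * expi t - z = - z * (1 - a * expi t) by rewrite /a; field.
  rewrite !normcM normcN !lnM ?posrE ?mulr_gt0 ?normc_gt0//; exact: n0.
under eq_fun do rewrite QE EP.
have cQ : continuous (fun t => ln (normc Q.[r%:C%C * expi t])).
  by apply: continuous_ln_normc => t; exact: n0.
have ca : continuous (fun t => ln (normc (1 - a * expi t))).
  have E t : 1 - a * expi t = (1 - a *: 'X).[1%:C%C * expi t].
    by rewrite hornerD hornerN hornerC hornerZ hornerX mul1r.
  under eq_fun do rewrite E.
  by apply: continuous_ln_normc => t; rewrite -E.
have cc : continuous (fun _ : R => ln (normc z)) by move=> t; exact: cst_continuous.
rewrite circintD//; last by move=> t; apply: cvgD; [exact: cc|exact: ca].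
rewrite circintD// circint_ln_normc1B// addr0 circint_cst (IH s1') -mulrDr QE sub0r.
by rewrite normcM normcN lnM ?posrE ?normc_gt0//; apply: n0; rewrite // normc0.
Qed.

(* The power sums [P_k = a^k + b^k] of the roots are polynomials in [z] without
   zeros in the disc, and [ln |P_k|] is within a constant of [k ln (rad T D)]. *)
Lemma circint_ln_rad (T D : {poly C}) (r : R) : 0 < r < 1 ->
  (forall z, 0 < normc z < 1 -> exists a b,
    [/\ T.[z] = a + b, D.[z] = a * b, 1 <= normc a & normc b <= normc z]) ->
  T.[0] != 0 -> D.[0] = 0 ->
  circint (fun t => ln (rad T.[r%:C%C * expi t] D.[r%:C%C * expi t])) =
    2 * pi * ln (normc T.[0]).
Proof.
move=> /andP[r0 r1] TD T0 D0.
have nre t : normc (r%:C%C * expi t) = r.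
  by rewrite normcM normc_expi mulr1 normc_real gtr0_norm.
have re1 t : 0 < normc (r%:C%C * expi t) < 1 by rewrite nre r0.
set F := fun t => ln _.
have cF : continuous F.
  apply: continuous_ln_rad => t; have [a [b [-> -> a1 b1]]] := TD _ (re1 t).
  by rewrite rad_max lt_max (lt_le_trans ltr01 a1).
set L := 2 * pi * _.
apply/eqP; rewrite -subr_eq0; apply/eqP.
(* The case of multiplier 0 only asks for a nonnegative bound; otherwise the power sum of exponent
   [k.+1] is used. *)
apply: (@archi_bounded0 _ _ (2 * pi * - ln (1 - r))) => -[|k].
  rewrite mul0r mulr_ge0 ?(ltW twopi_gt0)// oppr_ge0 ln_le0//; lra.
have [P hP] := power_sum_poly T D k.+1.
(* Since [D.[0] = 0], the two roots at 0 are [T.[0]] and 0. *)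
have P0 : P.[0] = T.[0] ^+ k.+1.
  by rewrite (hP 0 T.[0] 0) ?addr0 ?mulr0// expr0n addr0.
(* Take u = (b / a)^(k+1): then P = a^(k+1) (1 + u), the modulus of [a] is the spectral radius, and
   |u| <= |z| uniformly in [k]. *)
have Pz z : 0 < normc z < 1 -> P.[z] != 0 /\ exists u, [/\ normc u <= normc z, 1 + u != 0 &
    ln (normc P.[z]) = k.+1%:R * ln (rad T.[z] D.[z]) + ln (normc (1 + u))].
  move=> /[dup] /andP[z0 z1] /TD[a [b [Tz Dz a1 bz]]].
  have a0 : 0 < normc a := lt_le_trans ltr01 a1.
  have ba1 : normc (b / a) <= normc z.
    rewrite normcM normcV ler_pdivrMr//; apply: (le_trans bz).
    by rewrite ler_peMr// ltW.
  have u1 : normc ((b / a) ^+ k.+1) <= normc z.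
    rewrite normcX; apply: le_trans ba1; rewrite -[leRHS]expr1.
    rewrite ler_wiXn2l ?normc_ge0//; apply: le_trans (ltW z1).
    rewrite normcM normcV ler_pdivrMr//; apply: (le_trans bz).
    by rewrite ler_peMr// ltW.
  have un0 : 1 + (b / a) ^+ k.+1 != 0.
    rewrite -normc_gt0; have := normcD_ge 1 ((b / a) ^+ k.+1).
    by rewrite normc1; lra.
  have PzE : P.[z] = a ^+ k.+1 * (1 + (b / a) ^+ k.+1).
    rewrite (hP z a b)// mulrDr mulr1 -exprMn mulrCA mulfV ?mulr1//.
    by rewrite -normc_gt0.
  split; first by rewrite PzE mulf_neq0// expf_neq0// -normc_gt0.
  exists ((b / a) ^+ k.+1); split => //.
  rewrite Tz Dz rad_max max_l; last first.
    by apply: (le_trans bz); apply: le_trans a1; exact: ltW.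
  rewrite PzE normcM normcX lnM ?posrE ?exprn_gt0 ?normc_gt0// -?normc_gt0//.
  by rewrite lnXn// mulr_natl.
have Pn0 z : normc z < 1 -> P.[z] != 0.
  move=> z1; have [->|zn0] := eqVneq z 0; first by rewrite P0 expf_neq0.
  by apply: (Pz z _).1; rewrite normc_gt0 zn0.
have intP : circint (fun t => ln (normc P.[r%:C%C * expi t])) = k.+1%:R * L.
  rewrite circint_ln_normc_poly//; last by rewrite ltW.
  by rewrite P0 normcX lnXn ?normc_gt0// mulrnAr [RHS]mulr_natl.
have cP : continuous (fun t => ln (normc P.[r%:C%C * expi t])).
  by apply: continuous_ln_normc => t; exact: (Pz _ (re1 t)).1.
have ckF : continuous (fun t => - k.+1%:R * F t).
  by move=> t; apply: cvgMl_tmp; exact: cF.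
have -> : k.+1%:R * `|circint F - L| =
    `|circint (fun t => ln (normc P.[r%:C%C * expi t]) + - k.+1%:R * F t)|.
  rewrite circintD// circintZ// intP mulNr -mulrBr normrM.
  by rewrite distrC [in RHS]ger0_norm.
apply: circint_bound; first by move=> t; apply: cvgD; [exact: cP|exact: ckF].
move=> t; have [_ [u [ur u1 ->]]] := Pz _ (re1 t).
rewrite mulNr /F addrAC subrr add0r; apply: ln_normc1D_bound => //.
by rewrite -(nre t).
Qed.

Lemma normc_horner_bounded (P : {poly C}) :
  exists K, forall z, normc z <= 1 -> normc P.[z] <= K.
Proof.
elim/poly_ind: P => [|P c [K hK]]; first by exists 0 => z _; rewrite horner0 normc0.
exists (K + normc c) => z z1; rewrite !hornerE; apply: le_trans (le_normcD _ _) _.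
rewrite lerD2r normcM; apply: le_trans (hK z z1).
by rewrite ler_piMr// normc_ge0.
Qed.

(** Dominated convergence as the radius tends to 1. The lower bound on the unit circle keeps [ln]
    away from 0, so the limit integrand is continuous. *)
Lemma integral_ln_rad (T D : {poly C}) :
  (forall z, 0 < normc z < 1 -> exists a b,
    [/\ T.[z] = a + b, D.[z] = a * b, 1 <= normc a & normc b <= normc z]) ->
  (forall z, normc z = 1 -> 1 <= rad T.[z] D.[z]) ->
  T.[0] != 0 -> D.[0] = 0 ->
  (\int[mu]_(t in `[0%R, (2 * pi)%R]) (ln (rad T.[expi t] D.[expi t]))%:E =
    (2 * pi * ln (normc T.[0]))%:E)%E.
Proof.
move=> TD TD1 T0 D0.
(* The shift by 2 makes [r 0] equal to 1/2, so that every radius lies strictly between 0 and 1. *)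
pose r (m : nat) : R := 1 - m.+2%:R^-1.
have r01 m : 0 < r m < 1.
  have h : (0 : R) < m.+2%:R^-1 by rewrite invr_gt0.
  have h1 : m.+2%:R^-1 < (1 : R) by rewrite invf_lt1// ltr1n.
  by rewrite /r subr_gt0 h1 ltrBlDr ltrDl h.
have r1 : r @ \oo --> (1 : R).
  rewrite -[X in _ --> X]subr0; apply: cvgB; first exact: cvg_cst.
  by have := @cvg_harmonic R; rewrite -cvg_shiftS.
pose f (s t : R) := ln (rad T.[s%:C%C * expi t] D.[s%:C%C * expi t]).
have f1E t : ln (rad T.[expi t] D.[expi t]) = f 1 t by rewrite /f mul1r.
under eq_integral do rewrite f1E.
have nre (s t : R) : 0 <= s -> normc (s%:C%C * expi t) = s.
  by move=> s0; rewrite normcM normc_expi mulr1 normc_real ger0_norm.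
have cf1 : continuous (f 1).
  apply: continuous_ln_rad => t; apply: lt_le_trans ltr01 _.
  by apply: TD1; rewrite nre.
have cfr m : continuous (f (r m)).
  have /andP[r0 r1'] := r01 m.
  apply: continuous_ln_rad => t; have [|a [b [-> -> a1 b1]]] := TD ((r m)%:C%C * expi t).
    by rewrite nre ?r01// ltW.
  by rewrite rad_max lt_max (lt_le_trans ltr01 a1).
have [K hK] := normc_horner_bounded T.
(* With |a| >= 1 >= |b| one has 0 <= ln |a| <= |a| <= |T| + |b| <= K + 1. *)
have bf m t : `|f (r m) t| <= K + 1.
  have /andP[r0 r1'] := r01 m.
  have zE := nre (r m) t (ltW r0).
  have := hK ((r m)%:C%C * expi t); rewrite /f; move: zE; set z := _ * _ => zE.
  rewrite zE => /(_ (ltW r1')) TK.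
  have [|a [b [Tz Dz a1 b1]]] := TD z; first by rewrite zE r01.
  have a0 : 0 < normc a := lt_le_trans ltr01 a1.
  have b1' : normc b <= 1 by apply: (le_trans b1); rewrite zE ltW.
  rewrite Tz Dz rad_max max_l ?(le_trans b1')// ger0_norm ?ln_ge0//.
  apply: le_trans (ltW (ln_sublinear a0)) _.
  by have := normcD_ge a b; rewrite -Tz; lra.
have [||||||_ _ h] := @dominated_convergence _ _ R mu `[0%R, (2 * pi)%R] _
  (fun m => EFin \o f (r m)) (EFin \o f 1) (fun=> (K + 1)%:E) .
- by [].
- by move=> m; exact: measurable_int (continuous_integrable _ _ (cfr m)).
- exact: measurable_int (continuous_integrable _ _ cf1).
- apply: aeW => t _; apply/fine_cvgP; split; first exact: nearW.
  have E s : s%:C%C * expi t = (s * cos t +i* (s * sin t))%C by rewrite scaled_expi.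
  have c1 : 0 < rad T.[1%:C%C * expi t] D.[1%:C%C * expi t].
    by apply: lt_le_trans ltr01 _; apply: TD1; rewrite nre.
  apply: (cvg_comp _ (@ln R)); last exact: continuous_ln c1.
  have cr (b : R) : r m * b @[m --> \oo] --> 1 * b by exact: cvgMr_tmp.
  rewrite E; under eq_fun do rewrite E.
  exact: (cvg_rad_horner (P := T) (D := D) (cr (cos t)) (cr (sin t))).
- by apply: continuous_integrable => t; exact: cst_continuous.
- by apply: aeW => t m _; rewrite /= lee_fin.
(* By the mean value property the integrals do not depend on [m], so their limit is this common
   value. *)
have E : (fun m => \int[mu]_(x in `[0%R, (2 * pi)%R]) (EFin \o f (r m)) x)%E =
    (fun=> (2 * pi * ln (normc T.[0]))%:E).
  apply/funext => m; rewrite -(circint_ln_rad (r01 m) TD T0 D0) /circint /Rintegral fineK//.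
  exact: integrable_fin_num (continuous_integrable _ _ (cfr m)).
rewrite E in h.
by have := cvg_unique _ h (cvg_cst _); apply.
Qed.

End Mean.

(** * Mean of the log spectral radius over rotations, read off at z = 0 *)

Theorem theorem2 (R : realType) (n : nat) (n_ge1 : (1 <= n)%N)
    (A : 'I_n -> 'M[R]_2) (detA : forall j : 'I_n, \det (A j) = 1) :
  (((2 * pi)^-1)%:E *
     \int[@lebesgue_measure R]_(t in `[0%R, (2 * pi)%R])
        (ln (specrad (rotprod A t)))%:E
   = (\sum_(j < n) logN (A j))%:E)%E.
Proof.
pose B i := A (rev_ord i).
have dB i : \det (B i) = 1 by exact: detA.
have [T hT] := trace_poly B.
pose D : {poly R[i]} := 'X^(2 * n).
have hD z : D.[z] = \det (cprod B z) by rewrite det_cprod// hornerXn.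
have T0E : T.[0] = \prod_(i < n) alpha (B i) by rewrite hT trace_cprod0.
have T0 : T.[0] != 0.
  by rewrite T0E; apply/prodf_neq0 => i _; rewrite -normc_gt0 (logN_alpha (dB i)).2.
have D0 : D.[0] = 0 by rewrite hornerXn expr0n muln_eq0 /= eqn0Ngt n_ge1.
have TD z : 0 < normc z < 1 -> exists a b,
    [/\ T.[z] = a + b, D.[z] = a * b, 1 <= normc a & normc b <= normc z].
  move=> z01; have [a [b [Tz Dz a1 b1]]] := cprod_spectrum n_ge1 dB z01.
  exists a, b; rewrite hT hD; split => //; apply: (le_trans b1).
  (* As [n] is positive, |z|^(2n) <= |z|, the weaker bound that the mean value lemmas expect. *)
  case/andP: z01 => z0 z1; rewrite -[leRHS]expr1 ler_wiXn2l ?normc_ge0 ?ltW//.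
  by rewrite muln_gt0.
have TD1 z : normc z = 1 -> 1 <= rad T.[z] D.[z].
  move=> z1; have [a [b [Tz Dz]]] := quadratic_roots T.[z] D.[z].
  rewrite Tz Dz rad_max; by apply: (cprod_spectrum1 dB z1); rewrite -hD.
under eq_integral do rewrite specrad_rotprod -hT -hD.
rewrite integral_ln_rad// -EFinM mulKf ?gt_eqF ?twopi_gt0//.
(* The reversal of indices disappears because the moduli of the [alpha] commute; the logarithm then
   turns their product into a sum. *)
rewrite T0E normc_prod (reindex_inj rev_ord_inj) /=; congr EFin.
under eq_bigr do rewrite /B rev_ordK.
elim: n {n_ge1 B dB T hT D hD T0E T0 D0 TD TD1} A detA => [|n IH] A detA.
  by rewrite !big_ord0 ln1.
rewrite !big_ord_recr /= lnM ?posrE; last 2 first.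
- by apply: prodr_gt0 => i _; exact: (logN_alpha (detA _)).2.
- exact: (logN_alpha (detA _)).2.
by rewrite IH ?(logN_alpha (detA _)).1.
Qed.
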